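(* Let $H$ be a real Hilbert space, $C\subset H$ a nonempty closed convex set, and let $A,T:H\to H$ be mappings such that: (1) $A$ is monotone and $L$-Lipschitz continuous on $H$ for some $L>0$; (2) $T$ is $\lambda$-demicontractive for some $0\le\lambda<1$, and $I-T$ is demiclosed at zero; (3) $\operatorname{Fix}(T)\cap \mathrm{VI}(C,A)\neq\emptyset$; (4) $\{\theta_k\}_{k\ge1}\subset(0,1)$ satisfies $\lim_{k\to\infty}\theta_k=0$ and $\sum_{k=1}^\infty\theta_k=\infty$; $\{\zeta_k\}_{k\ge1}$ is a sequence of positive numbers with $\lim_{k\to\infty}\zeta_k/\theta_k=0$; and $\{\eta_k\}_{k\ge1}$ is a positive sequence for which there are $a>0$, $b>0$ such that $\eta_k\in(a,b)\subset\big(0,(1-\lambda)(1-\theta_k)\big)$ for all $k$. Let $\delta>0$, $\gamma_1>0$, $\phi\in(0,1)$, let $x^0,x^1\in H$ be arbitrary, and for $k\ge1$ define $$s^k=x^k+\delta_k(x^k-x^{k-1}),\qquad \delta_k=\begin{cases}\min\Big\{\dfrac{\zeta_k}{\|x^k-x^{k-1}\|},\delta\Big\}, & x^k\ne x^{k-1},\\ \delta, & \text{otherwise},\end{cases}$$ $$y^k=P_C(s^k-\gamma_kAs^k),\qquad H_k=\{x\in H:\langle s^k-\gamma_kAs^k-y^k,\,x-y^k\rangle\le0\},\qquad z^k=P_{H_k}(s^k-\gamma_kAy^k),$$ $$x^{k+1}=(1-\theta_k-\eta_k)z^k+\eta_kTz^k,$$ $$\gamma_{k+1}=\begin{cases}\min\Big\{\dfrac{\phi\|s^k-y^k\|}{\|As^k-Ay^k\|},\gamma_k\Big\},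 & As^k-Ay^k\neq0,\\ \gamma_k, & \text{otherwise}.\end{cases}$$ Then the sequence $\{x^k\}$ converges in norm to $u\in\operatorname{Fix}(T)\cap\mathrm{VI}(C,A)$, where $\|u\|=\min\{\|p\|:p\in\operatorname{Fix}(T)\cap\mathrm{VI}(C,A)\}$.
   Context: $\operatorname{Fix}(T)=\{p\in H:Tp=p\}$. $\mathrm{VI}(C,A)=\{p\in C:\langle Ap,x-p\rangle\ge0\ \ \forall x\in C\}$. $P_D$ is the metric projection of $H$ onto a nonempty closed convex set $D$. $I$ is the identity on $H$. $A$ is monotone if $\langle Ax-Ay,x-y\rangle\ge0$ for all $x,y\in H$, and $L$-Lipschitz continuous if $\|Ax-Ay\|\le L\|x-y\|$ for all $x,y\in H$. $T$ is $\lambda$-demicontractive ($0\le\lambda<1$) if $\|Tx-z\|^2\le\|x-z\|^2+\lambda\|(I-T)x\|^2$ for all $x\in H$ and all $z\in\operatorname{Fix}(T)$. $I-T$ is demiclosed at zero if, for every sequence $\{v^k\}\subset H$, $v^k\rightharpoonup v$ (weakly) and $(I-T)v^k\to0$ (in norm) imply $v\in\operatorname{Fix}(T)$. Superscripts on vectors are sequence indices. *)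

(* Defs.v *)
From mathcomp Require Import all_boot all_order all_algebra.
From mathcomp Require Import all_classical all_reals all_analysis.

Set Implicit Arguments.
Unset Strict Implicit.
Unset Printing Implicit Defensive.

Import Order.TTheory GRing.Theory Num.Theory.
Import numFieldNormedType.Exports.

Local Open Scope classical_set_scope.
Local Open Scope ring_scope.

(* A real Hilbert space is a complete normed module [H] together with a
   positive definite symmetric bilinear form [dot : {dot H for @idfun R}] such
   that [`|x| ^+ 2 = dot x x]. *)

Section Hilbert.
Context {R : realType} {H : completeNormedModType R}.
Implicit Types (dot : {dot H for @idfun R}) (A T : H -> H) (C D : set H).

Definition Fix T : set H := [set p | T p = p].

Definition VI dot C A : set H :=
  [set p | C p /\ forall x, C x -> 0 <= dot (A p) (x - p)].

(* The nearest point of [D] to [x]; the default value 0 is only returned when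
   no nearest point exists, hence never for [D] nonempty, closed and convex. *)
Definition metric_proj D (x : H) : H :=
  xget 0 [set p | D p /\ forall q, D q -> `|x - p| <= `|x - q|].

Definition monotone_op dot A : Prop :=
  forall x y, 0 <= dot (A x - A y) (x - y).

Definition demicontractive (lambda : R) T : Prop :=
  forall x z, Fix T z ->
    `|T x - z| ^+ 2 <= `|x - z| ^+ 2 + lambda * `|x - T x| ^+ 2.

Definition weakly_cvg dot (v : nat -> H) (l : H) : Prop :=
  forall w, dot (v k) w @[k --> \oo] --> dot l w.

Definition demiclosed_at_zero dot T : Prop :=
  forall (v : nat -> H) (l : H),
    weakly_cvg dot v l -> (v k - T (v k)) @[k --> \oo] --> (0 : H) ->
    Fix T l.

End Hilbert.

(* Main.v *)
Require Import Defs.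
From mathcomp Require Import all_boot all_order all_algebra.
From mathcomp Require Import all_classical all_reals all_analysis.
From mathcomp Require Import lra ring.
Import Order.TTheory GRing.Theory Num.Theory.
Import numFieldNormedType.Exports.
Local Open Scope classical_set_scope.
Local Open Scope ring_scope.

Set Implicit Arguments.
Unset Strict Implicit.
Unset Printing Implicit Defensive.

(** Let [Omega] be the set of fixed points of [T] solving the variational
inequality, and let [u] be its point of least norm.  Both constraints can be
written with half-spaces only: demicontractivity turns [T z = z] into a family
of linear inequalities on [z] (Fix_halfspaces), and so does Minty's
reformulation of the variational inequality (VI_halfspaces).  Hence [Omega] is
closed and convex, [u] exists as the projection of [0], and [0 <= dot u (p - u)]
for every [p] in [Omega].

One step of the iteration is quasi-contractive towards each solution [p].  The
step sizes [gamma k] decrease to a positive limit, so that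
[gamma k / gamma k.+1] tends to [1] and the extragradient step eventually
satisfies [|z k - p|^2 <= |s k - p|^2 - c (|s k - y k|^2 + |y k - z k|^2)]
(fejer).  The relaxed step through [T] loses a further multiple of
[|z k - T (z k)|^2].  The inertial term moves [x k] by at most [zeta k], which
is negligible with respect to [theta k].  With [r k] the sum of the three
squared residuals and [d k = |x k - u|^2] this gives (x_step_sqr), eventually,
[d k.+1 <= (1 - theta k) d k + theta k (2 dot u (u - x k.+1) + o(1)) - c r k].

It remains to control [dot u (u - x k.+1)].  When [r k] is small it is almost
nonpositive (residual_small): otherwise some sequence of indices with [r k]
tending to [0] keeps it above a positive constant; along a weakly convergent
subsequence (weak_subsequence) the iterates approach weakly a point of [Omega]
(weak_limit_sol), which contradicts the choice of [u].  When [r k] is not small,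
the term [- c r k] outweighs everything multiplied by [theta k], because
[theta k] tends to [0].  In both cases
[d k.+1 <= (1 - theta k) d k + theta k eps] for all large [k], and the divergence
of the series of the [theta k] brings [d k] below [2 eps] (eventually_small). *)

(** * Real numbers and sequences *)

(** If [c < b], a point of [`]a, b[] close enough to [b] lies beyond [c]. *)
Lemma itv_sub_le (R : realType) (a b c : R) : a < b ->
  [set` `]a, b[] `<=` [set` `]0, c[] -> b <= c.
Proof.
move=> ab sub; rewrite leNgt; apply/negP => cb.
(* the first argument keeps [t] above [a], the second above [c] *)
pose t := Num.max ((a + b) / 2) ((c + b) / 2).
have : t \in `]0, c[.
  apply: sub; rewrite /= in_itv /= /t lt_max gt_max; apply/and3P; split; last lra.
    by apply/orP; left; lra.
  by lra.
rewrite in_itv /= /t gt_max => /and3P[_ _]; lra.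
Qed.

Lemma divergent_partial_sums (R : realType) (theta : nat -> R) :
  (forall k, (1 <= k)%N -> 0 <= theta k) ->
  (\sum_(1 <= k <oo) (theta k)%:E = +oo)%E ->
  forall B : R, exists n, B < \sum_(1 <= k < n) theta k.
Proof.
move=> t0 tsum B; apply: contrapT => /forallNP hB.
suff : (\sum_(1 <= k <oo) (theta k)%:E <= B%:E)%E by rewrite tsum.
apply: lime_le.
  by apply: is_cvg_nneseries_cond => k k1 _; rewrite lee_fin t0.
by apply: nearW => n; rewrite sumEFin lee_fin leNgt; apply/negP; exact: hB.
Qed.

(** If [a] stayed above [2 * eps], each step would lower it by at least
[theta n * eps], and the divergence of the series would make it negative.  So
[a] drops below [2 * eps] at some index, and the recursion, a convex combination
of [a n] and [eps], keeps it there. *)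
Lemma eventually_small (R : realType) (a theta : nat -> R) (eps : R) N :
    0 < eps -> (1 <= N)%N -> (forall k, (1 <= k)%N -> 0 < theta k < 1) ->
    (forall B : R, exists n, B < \sum_(1 <= k < n) theta k) ->
    (forall n, 0 <= a n) ->
    (forall n, (N <= n)%N -> a n.+1 <= (1 - theta n) * a n + theta n * eps) ->
  exists N', forall n, (N' <= n)%N -> a n <= 2 * eps.
Proof.
move=> eps0 N1 t01 tsum a0 rec.
suff [N' NN' aN'] : exists2 N', (N <= N')%N & a N' <= 2 * eps.
  exists N' => n /subnK <-; elim: (n - N')%N => [//|m ih].
  have Nm : (N <= m + N')%N by rewrite (leq_trans NN')// leq_addl.
  have /andP[tm0 tm1] := t01 _ (leq_trans N1 Nm).
  rewrite addSn; apply: (le_trans (rec _ Nm)).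
  have tm1' : 0 <= 1 - theta (m + N')%N by lra.
  have := ler_wpM2l tm1' ih.
  by have := mulr_gt0 tm0 eps0; lra.
apply: contrapT => no.
have big n : (N <= n)%N -> 2 * eps < a n.
  by move=> Nn; rewrite ltNge; apply/negP => h; apply: no; exists n.
pose S n := \sum_(1 <= k < n) theta k.
have bound n : (N <= n)%N -> a n + eps * S n <= a N + eps * S N.
  move=> /subnK <-; elim: (n - N)%N => [//|m ih].
  have Nm : (N <= m + N)%N by rewrite leq_addl.
  have Nm1 := leq_trans N1 Nm.
  have /andP[tm0 tm1] := t01 _ Nm1.
  rewrite addSn {1}/S big_nat_recr//= -/(S (m + N)%N).
  have := rec _ Nm; have := big _ Nm; rewrite -subr_gt0 => /(mulr_gt0 tm0).
  by move: ih; lra.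
have [n hn] := tsum ((a N + eps * S N) / eps).
move: hn; rewrite ltr_pdivrMr// mulrC -/(S n).
have [Nn|/ltnW nN] := leqP N n.
  by have := bound n Nn; have := a0 n; lra.
have : S n <= S N.
  rewrite /S; have [n1|n1] := leqP 1 n; last first.
    rewrite big_geq ?(ltnW n1)// big_nat_cond sumr_ge0// => i /andP[/andP[i1 _] _].
    by case/andP: (t01 _ i1) => /ltW.
  rewrite (big_cat_nat n1 nN)//= lerDl big_nat_cond sumr_ge0// => i.
  move=> /andP[/andP[ni _] _].
  by case/andP: (t01 _ (leq_trans n1 ni)) => /ltW.
by move=> /(ler_wpM2l (ltW eps0)); have := a0 N; lra.
Qed.

Lemma cvgn_distP {R : realType} {V : pseudoMetricNormedZmodType R}
    {u : nat -> V} {l : V} :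
  u n @[n --> \oo] --> l <->
  forall e : R, 0 < e -> exists N, forall n, (N <= n)%N -> `|l - u n| < e.
Proof.
split=> [/cvgrPdist_lt ul e /ul[N _ hN]|ul]; first by exists N.
by apply/cvgrPdist_lt => e /ul[N hN]; exists N.
Qed.

Lemma cvg0_harmonic_sqr {R : realType} {V : pseudoMetricNormedZmodType R}
    (w : nat -> V) :
  (forall n, `|w n| ^+ 2 <= harmonic n) -> w n @[n --> \oo] --> (0 : V).
Proof.
move=> wn; apply/cvgn_distP => e e0.
have [N hN] := cvgn_distP.1 (@cvg_harmonic R) _ (exprn_gt0 2 e0).
exists N => n /hN; rewrite !sub0r !normrN ger0_norm ?harmonic_ge0// => h.
rewrite -(ltr_pXn2r (n := 2))// ?nnegrE ?(ltW e0)//.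
exact: le_lt_trans (wn n) h.
Qed.

(** * Inner products, half-spaces and convex sets *)

Section InnerProduct.
Context {R : realType} {H : completeNormedModType R}.
Context (dot : {dot H for @idfun R}).
Context (norm_dot : forall x : H, `|x| ^+ 2 = dot x x).
Implicit Types (x y z u v w : H) (D : set H) (M c e : R).

Lemma dotC u v : dot u v = dot v u.
Proof. by rewrite hermC expr0 mul1r. Qed.

Lemma dotDl u v w : dot (u + v) w = dot u w + dot v w.
Proof. exact: linearDl. Qed.
Lemma dotNl u w : dot (- u) w = - dot u w.
Proof. exact: linearNl. Qed.
Lemma dotZl c u w : dot (c *: u) w = c * dot u w.
Proof. exact: linearZl_LR. Qed.
Lemma dotDr u v w : dot w (u + v) = dot w u + dot w v.
Proof. by rewrite dotC dotDl !(dotC w). Qed.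
Lemma dotNr u w : dot w (- u) = - dot w u.
Proof. by rewrite dotC dotNl dotC. Qed.
Lemma dotZr c u w : dot w (c *: u) = c * dot w u.
Proof. by rewrite dotC dotZl dotC. Qed.
Definition dotE := (dotDl, dotDr, dotNl, dotNr, dotZl, dotZr).

Lemma dot_ge0 x : 0 <= dot x x.
Proof. by rewrite -norm_dot sqr_ge0. Qed.

Lemma normDsqr x y : `|x + y| ^+ 2 = `|x| ^+ 2 + 2 * dot x y + `|y| ^+ 2.
Proof. by rewrite !norm_dot !dotE (dotC y x); ring. Qed.

Lemma normBsqr x y : `|x - y| ^+ 2 = `|x| ^+ 2 - 2 * dot x y + `|y| ^+ 2.
Proof. by rewrite !norm_dot !dotE (dotC y x); ring. Qed.

(** Expand the square of [`|y| *: x - `|x| *: y], which is nonnegative. *)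
Lemma CauchySchwarz_dot x y : dot x y <= `|x| * `|y|.
Proof.
have [->|x0] := eqVneq x 0.
  by rewrite -(scale0r 0) dotZl mul0r scale0r normr0 mul0r.
have [->|y0] := eqVneq y 0.
  by rewrite -(scale0r 0) dotZr mul0r scale0r normr0 mulr0.
have xp : 0 < `|x| by rewrite normr_gt0.
have yp : 0 < `|y| by rewrite normr_gt0.
have := dot_ge0 (`|y| *: x - `|x| *: y).
rewrite !dotE (dotC y x) -!norm_dot => h.
have : 0 <= (2 * (`|x| * `|y|)) * (`|x| * `|y| - dot x y) by lra.
by rewrite pmulr_rge0 ?mulr_gt0// subr_ge0.
Qed.

Lemma norm_dot_le x y : `|dot x y| <= `|x| * `|y|.
Proof.
rewrite ler_norml CauchySchwarz_dot andbT lerNl -dotNl -(normrN x).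
exact: CauchySchwarz_dot.
Qed.

Lemma closed_distP D :
  closed D <-> forall p, (forall e : R, 0 < e -> exists2 q, D q & `|p - q| < e) -> D p.
Proof.
split=> [cD p hp|h p clp].
  apply: cD => B /nbhs_ballP[e /= e0 eB].
  have [q Dq pq] := hp _ e0; exists q; split => //; apply: eB.
  by rewrite -ball_normE.
apply: h => e e0; have [q [Dq]] := clp _ (nbhsx_ballx p e e0).
by rewrite -ball_normE => pq; exists q.
Qed.

Lemma convex_setP D : convex_set D <->
  forall p q (t : R), 0 <= t <= 1 -> D p -> D q -> D (t *: p + (1 - t) *: q).
Proof.
split=> [cD p q t t01 Dp Dq|h p q t].
  move: (cD p q (Itv01 (andP t01).1 (andP t01).2)).
  by rewrite !inE; apply.
rewrite !inE => Dp Dq; apply: h => //.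
by apply/andP; split.
Qed.

Lemma closed_halfspace w c : closed [set x | dot x w <= c].
Proof.
apply/closed_distP => p hp; rewrite /= leNgt; apply/negP => cp.
have [e e0 we] : exists2 e, 0 < e & e * `|w| < dot p w - c.
  have w1 : 0 < `|w| + 1 by rewrite ltr_wpDl.
  exists ((dot p w - c) / (`|w| + 1)); first by rewrite divr_gt0 ?subr_gt0.
  by rewrite mulrAC ltr_pdivrMr// ltr_pM2l ?subr_gt0// ltrDl.
have [q /= qc /ltW pq] := hp _ e0.
have := le_trans (CauchySchwarz_dot (p - q) w) (ler_wpM2r (normr_ge0 w) pq).
by rewrite !dotE; lra.
Qed.

Lemma convex_halfspace w c : convex_set [set x : H | dot x w <= c].
Proof.
apply/convex_setP => p q t /andP[t0 t1] /= hp hq; rewrite !dotE.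
have t1' : 0 <= 1 - t by lra.
have := ler_wpM2l t0 hp; have := ler_wpM2l t1' hq; lra.
Qed.

(** The relation [P] lists the normals and offsets of the half-spaces, so that a
family may be indexed by anything, such as the points subject to a
constraint. *)
Lemma closed_halfspaces (P : H -> R -> Prop) :
  closed [set x | forall w c, P w c -> dot x w <= c].
Proof.
apply/closed_distP => p hp w c Pwc.
have /closed_distP/(_ p) := @closed_halfspace w c; apply => e e0.
by have [q hq pq] := hp e e0; exists q => //; exact: hq.
Qed.

Lemma convex_halfspaces (P : H -> R -> Prop) :
  convex_set [set x : H | forall w c, P w c -> dot x w <= c].
Proof.
apply/convex_setP => p q t t01 hp hq w c Pwc.
have /convex_setP/(_ p q t t01) := @convex_halfspace w c.
by apply; [exact: hp|exact: hq].
Qed.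

(** * Metric projection *)

Lemma cauchy_seq_cvg (u : nat -> H) :
  (forall e : R, 0 < e -> exists N, forall n, (N <= n)%N -> `|u N - u n| < e) ->
  exists l : H, u n @[n --> \oo] --> l.
Proof.
move=> hu; suff /cauchy_cvgP : cauchy (u n @[n --> \oo]).
  by move=> cu; exists (lim (u n @[n --> \oo])).
apply/cauchyP => e e0; have [N hN] := hu _ e0.
exists (u N); exists N => // n /= Nn.
by rewrite -ball_normE /=; exact: hN.
Qed.

(** A minimizing sequence is Cauchy by the parallelogram law, since the midpoint of
two of its terms lies in [D] and is no closer to [x] than the infimum. *)
Lemma nearest_point_ex D x : D !=set0 -> closed D -> convex_set D ->
  exists p, D p /\ forall q, D q -> `|x - p| <= `|x - q|.
Proof.
move=> [q0 Dq0] cD /convex_setP convD.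
pose E := [set `|x - q| ^+ 2 | q in D].
have lbE : lbound E 0 by move=> _ [q _ <-]; exact: sqr_ge0.
have infE : has_inf E by split; [exists (`|x - q0| ^+ 2), q0|exists 0].
pose d := inf E.
have dle q : D q -> d <= `|x - q| ^+ 2.
  by move=> Dq; apply: ge_inf; [exists 0|exists q].
have /choice[v hv] n : exists q, D q /\ `|x - q| ^+ 2 < d + harmonic n.
  have [_ [q Dq <-] qd] := inf_adherent (harmonic_gt0 n) infE.
  by exists q.
have vv n m : `|v n - v m| ^+ 2 <= 2 * (harmonic n + harmonic m).
  have [Dn hn] := hv n; have [Dm hm] := hv m.
  have half01 : 0 <= (2^-1 : R) <= 1 by apply/andP; split; lra.
  have := dle _ (convD _ _ _ half01 Dn Dm).
  have -> : x - (2^-1 *: v n + (1 - 2^-1) *: v m) =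
            2^-1 *: (x - v n) + 2^-1 *: (x - v m).
    have -> : 1 - 2^-1 = 2^-1 :> R by lra.
    rewrite !scalerBr opprD addrACA -scalerDl.
    by rewrite (_ : 2^-1 + 2^-1 = 1) ?scale1r//; lra.
  have -> : v n - v m = (x - v m) - (x - v n).
    by rewrite opprB [RHS]addrC subrKA.
  rewrite (normDsqr (2^-1 *: _)) (normBsqr (x - v m)) !normrZ ger0_norm ?invr_ge0// dotZl dotZr.
  rewrite (dotC (x - v m)) !exprMn.
  by lra.
have [p vp] : exists p : H, v n @[n --> \oo] --> p.
  apply: cauchy_seq_cvg => e e0.
  have e40 : 0 < e ^+ 2 / 4 by rewrite divr_gt0 ?exprn_gt0.
  have [N hN] := cvgn_distP.1 (@cvg_harmonic R) _ e40.
  have {}hN n : (N <= n)%N -> harmonic n < e ^+ 2 / 4.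
    by move=> /hN; rewrite sub0r normrN ger0_norm ?harmonic_ge0.
  exists N => n Nn; rewrite -(ltr_pXn2r (n := 2))// ?nnegrE ?(ltW e0)//.
  by have := vv N n; have := hN N (leqnn N); have := hN n Nn; lra.
exists p; split.
  by apply: (closed_cvg _ cD _ _ vp); near=> n; exact: (hv n).1.
move=> q Dq; rewrite -(ler_pXn2r (n := 2)) ?nnegrE//.
have h1 : `|x - v n| ^+ 2 @[n --> \oo] --> `|x - p| ^+ 2.
  have h : `|x - v n| @[n --> \oo] --> `|x - p|.
    by apply: cvg_norm; apply: cvgB => //; exact: cvg_cst.
  exact: (cvgM h h).
have h2 : `|x - q| ^+ 2 + harmonic n @[n --> \oo] --> `|x - q| ^+ 2.
  by rewrite -[X in _ --> X]addr0; apply: cvgD; [exact: cvg_cst|exact: cvg_harmonic].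
apply: (ler_cvg_to h1 h2); near=> n.
by apply: (le_trans (ltW (hv n).2)); rewrite lerD2r dle.
Unshelve. all: by end_near. Qed.

(** The obtuse-angle property: if the inner product were some [c > 0], moving from
the projection towards [q] by a small proportion [t] would come closer to [x].
The value [t = c / (c + `|q - p| ^+ 2)] suffices. *)
Lemma metric_projP D x : D !=set0 -> closed D -> convex_set D ->
  D (metric_proj D x) /\
  forall q, D q -> dot (x - metric_proj D x) (q - metric_proj D x) <= 0.
Proof.
move=> D0 cD convD.
have [] := xgetPex 0 (nearest_point_ex x D0 cD convD).
rewrite -/(metric_proj D x); set p := metric_proj D x => Dp pmin.
split => // q Dq; rewrite leNgt; apply/negP.
set c := dot _ _ => c0.
have N0 := sqr_ge0 `|q - p|; set N := `|q - p| ^+ 2 in N0.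
have cN : 0 < c + N by rewrite ltr_pwDl.
pose t := c / (c + N).
have t0 : 0 < t by rewrite divr_gt0.
have t1 : t <= 1 by rewrite ler_pdivrMr// mul1r lerDl.
have t01 : 0 <= t <= 1 by rewrite (ltW t0).
have := pmin _ ((convex_setP D).1 convD _ _ _ t01 Dq Dp).
have -> : x - (t *: q + (1 - t) *: p) = (x - p) - t *: (q - p).
  by rewrite scalerBl scale1r addrCA -scalerBr opprD addrA.
rewrite -(ler_pXn2r (n := 2)) ?nnegrE// (normBsqr (x - p)) dotZr -/c normrZ exprMn.
rewrite real_normK ?num_real// -/N => h.
have : 0 <= t * (t * N - 2 * c) by lra.
rewrite pmulr_rge0// /t mulrAC subr_ge0 ler_pdivlMr// mulrAC => h2.
have : 0 < c * (c + N) by rewrite mulr_gt0.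
have : 0 <= c * c by rewrite mulr_ge0// ltW.
by lra.
Qed.

(** Testing weak convergence against [l - p], with [p] the projection of [l],
forces [l = p]. *)
Lemma weakly_closed D : closed D -> convex_set D -> forall (v : nat -> H) l,
  (forall n, D (v n)) -> weakly_cvg dot v l -> D l.
Proof.
move=> cD convD v l Dv vl; have D0 : D !=set0 by exists (v 0%N).
have [Dp hp] := metric_projP l D0 cD convD.
set p := metric_proj D l in Dp hp.
suff : l = p by move=> ->.
apply/eqP; rewrite -subr_eq0 -normr_eq0 -sqrf_eq0 eq_le sqr_ge0 andbT.
have h : dot (v n) (l - p) @[n --> \oo] --> dot l (l - p) := vl _.
rewrite norm_dot {1}dotDl dotNl subr_le0.
apply: (closed_cvg (fun r => r <= dot p (l - p)) (@closed_le _ _) _ _ h).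
near=> n; have := hp _ (Dv n); rewrite dotC dotDl dotNl subr_le0; exact.
Unshelve. all: by end_near. Qed.

(** * Weak sequential compactness *)

(** The sets [K n] cut out by all the half-spaces containing the tail of [v] are
closed, convex and decreasing.  Their points of least norm have increasing,
bounded norms, hence form a Cauchy sequence, and its limit [l] lies in every
[K n].  If [dot (v k) w] converges, its limit is then [dot l w], so that [l] is the
only candidate for a weak limit. *)
Lemma bounded_limit_point (v : nat -> H) M : (forall n, `|v n| <= M) ->
  exists l : H, forall n w c,
    (forall k, (n <= k)%N -> dot (v k) w <= c) -> dot l w <= c.
Proof.
move=> vM.
pose K n := [set x : H | forall w c,
  (forall k, (n <= k)%N -> dot (v k) w <= c) -> dot x w <= c].
have Kv n : K n (v n) by move=> w c; exact.
have Kdecr n m : (n <= m)%N -> K m `<=` K n.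
  by move=> nm x Kx w c h; apply: Kx => k mk; apply: h; exact: leq_trans mk.
have cK n : closed (K n) by exact: closed_halfspaces.
have convK n : convex_set (K n) by exact: convex_halfspaces.
pose p n := metric_proj (K n) 0.
have K0 n : K n !=set0 by exists (v n).
have Kp n : K n (p n) := (metric_projP 0 (K0 n) (cK n) (convK n)).1.
have pmin n q : K n q -> `|p n| ^+ 2 <= dot (p n) q.
  move=> /((metric_projP 0 (K0 n) (cK n) (convK n)).2 q).
  by rewrite -/(p n) !dotE norm_dot -(scale0r 0) !dotZl; lra.
have pM n : `|p n| ^+ 2 <= M ^+ 2.
  have := pmin n _ (Kv n); have := CauchySchwarz_dot (p n) (v n).
  have := ler_wpM2l (normr_ge0 (p n)) (vM n).
  have := sqr_ge0 (`|p n| - M); lra.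
have pdist n m : (n <= m)%N -> `|p n - p m| ^+ 2 <= `|p m| ^+ 2 - `|p n| ^+ 2.
  by move=> nm; have := pmin n _ (Kdecr _ _ nm _ (Kp m)); rewrite normBsqr; lra.
have pincr : nondecreasing_seq (fun n => `|p n| ^+ 2).
  by move=> n m nm; rewrite -subr_ge0; apply: le_trans (pdist _ _ nm); exact: sqr_ge0.
have cvp : cvgn (fun n => `|p n| ^+ 2).
  by apply: nondecreasing_is_cvgn => //; exists (M ^+ 2) => _ [n _ <-].
have ple := nondecreasing_cvgn_le pincr cvp.
have [l pl] : exists l : H, p n @[n --> \oo] --> l.
  apply: cauchy_seq_cvg => e e0.
  have [N hN] := cvgn_distP.1 cvp _ (exprn_gt0 2 e0).
  exists N => n Nn; rewrite -(ltr_pXn2r (n := 2))// ?nnegrE ?(ltW e0)//.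
  have := hN N (leqnn N); rewrite ger0_norm ?subr_ge0//.
  by have := ple n; have := pdist _ _ Nn => /=; lra.
exists l => n; apply: (closed_cvg _ (cK n) _ _ pl).
by exists n => // m /= nm; exact: (Kdecr _ _ nm _ (Kp m)).
Qed.

Lemma ultra_bounded_cvg (U : set_system nat) (r : nat -> R) M :
  UltraFilter U -> (forall n, `|r n| <= M) ->
  exists c : R, r n @[n --> U] --> c.
Proof.
move=> UU rM.
have [c [_ clc]] : `[- M, M] `&` cluster (r @ U) !=set0.
  apply: segment_compact; rewrite /fmap /=; apply: filterE => n /=.
  by rewrite in_itv /= -ler_norml rM.
exists c => B Bc.
have [UB|UB] := in_ultra_setVsetC (r @^-1` B) UU; first exact: UB.
by have [x [nBx Bx]] := clc (~` B) B UB Bc; case: (nBx Bx).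
Qed.

(** An ultrafilter on the indices gives limits to all the real sequences
[dot (v n) (v j)] at once, and replaces the diagonal extraction: [f k] is chosen
so that the first [k.+1] of these products are within [harmonic k] of their
limits.  A limit point [l] of the extracted sequence is then its weak limit: the
set [S] of the test vectors along which convergence holds is a closed subspace
containing every [v j], and every vector orthogonal to [S] is orthogonal to the
sequence and to [l]. *)
Lemma weak_subsequence (v : nat -> H) M : (forall n, `|v n| <= M) ->
  exists (f : nat -> nat) (l : H),
    (forall n, (n <= f n)%N) /\ weakly_cvg dot (fun n => v (f n)) l.
Proof.
move=> vM.
have [U [UU ooU]] := ultraFilterLemma eventually_filter.
have /choice[g hg] j : exists c : R, dot (v n) (v j) @[n --> U] --> c.
  apply: (@ultra_bounded_cvg _ _ (M * M)) => n.
  by apply: (le_trans (norm_dot_le _ _)); rewrite ler_pM.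
have /choice[f hf] k : exists n, (k <= n)%N /\
    forall j : 'I_k.+1, `|g j - dot (v n) (v j)| < harmonic k.
  apply: (@filter_ex _ U); apply: filterI; first by apply: ooU; exists k.
  apply: filter_forall => j.
  by have /cvgrPdist_lt := hg j; apply; exact: harmonic_gt0.
have fj j : dot (v (f k)) (v j) @[k --> \oo] --> g j.
  apply/cvgn_distP => e e0.
  have [N hN] := cvgn_distP.1 (@cvg_harmonic R) _ e0.
  exists (maxn N j) => n; rewrite geq_max => /andP[/hN + jn].
  rewrite sub0r normrN ger0_norm ?harmonic_ge0//; apply: lt_trans.
  by have /= := (hf n).2 (Ordinal (n := n.+1) (m := j) jn).
have [l hl] := bounded_limit_point (fun n => vM (f n)).
exists f, l; split; first by move=> n; exact: (hf n).1.
pose S := [set w : H | dot (v (f k)) w @[k --> \oo] --> dot l w].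
have Sv j : S (v j).
  rewrite /S /=; suff -> : dot l (v j) = g j by [].
  have hle e : 0 < e -> dot l (v j) <= g j + e /\ g j - e <= dot l (v j).
    move=> e0; have [N hN] := cvgn_distP.1 (fj j) _ e0.
    split; first apply: (hl N) => k /hN.
      by rewrite ltr_norml; lra.
    rewrite -lerN2 -dotNr opprB; apply: (hl N) => k /hN.
    by rewrite dotNr ltr_norml; lra.
  apply/eqP; rewrite eq_le; apply/andP; split; apply/ler_addgt0Pr => e e0.
    exact: (hle e e0).1.
  by have := (hle e e0).2; lra.
have SZD c w1 w2 : S w1 -> S w2 -> S (c *: w1 + w2).
  move=> S1 S2; rewrite /S /= !dotE.
  under eq_fun do rewrite !dotE.
  by apply: cvgD => //; apply: cvgM => //; exact: cvg_cst.
have S0 : S 0.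
  rewrite /S /= -(scale0r 0) dotZr mul0r; under eq_fun do rewrite dotZr mul0r.
  exact: cvg_cst.
have cS : closed S.
  apply/closed_distP => w hw; apply/cvgn_distP => e e0.
  have M0 : 0 < `|M| + `|l| + 1 by rewrite ltr_wpDl// addr_ge0.
  have d0 : 0 < (e / 2) / (`|M| + `|l| + 1) by rewrite !divr_gt0.
  have [q Sq wq] := hw _ d0.
  have e20 : 0 < e / 2 by rewrite divr_gt0.
  have [N hN] := cvgn_distP.1 Sq _ e20.
  exists N => n /hN.
  have -> : dot l w - dot (v (f n)) w =
    (dot l q - dot (v (f n)) q) + dot (l - v (f n)) (w - q).
    by rewrite !dotE; ring.
  move=> h; apply: (le_lt_trans (ler_normD _ _)).
  rewrite [ltRHS](splitr e) ltr_leD//.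
  apply: (le_trans (norm_dot_le _ _)).
  move: wq; rewrite ltr_pdivlMr// => /ltW; apply: le_trans.
  rewrite mulrC ler_wpM2l// (le_trans (ler_normB _ _))// addrC.
  rewrite -addrA lerD// ?(le_trans (vM _))// ?ler_norm//.
  by rewrite lerDl.
have convS : convex_set S.
  apply/convex_setP => p q t _ Sp Sq; apply: (SZD _ _ _ Sp).
  by rewrite -[X in S X]addr0; exact: SZD.
move=> w; have S00 : S !=set0 by exists 0.
have [Sq hq] := metric_projP w S00 cS convS.
set q := metric_proj S w in Sq hq; pose r := w - q.
have rS s : S s -> dot r s <= 0.
  move=> Ss; have := hq (1 *: s + q) (SZD _ _ _ Ss Sq).
  by rewrite scale1r addrK.
have rv j : dot r (v j) = 0.
  apply/eqP; rewrite eq_le rS//= -oppr_le0 -dotNr; apply: rS.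
  by rewrite -scaleN1r -[X in S X]addr0; exact: SZD.
have lr : dot l r = 0.
  apply/eqP; rewrite eq_le; apply/andP; split.
    by apply: (hl 0%N) => k _; rewrite dotC rv.
  by rewrite -oppr_le0 -dotNr; apply: (hl 0%N) => k _; rewrite dotNr dotC rv oppr0.
have -> : w = q + r by rewrite /r addrC subrK.
rewrite dotDr lr addr0.
by under eq_fun do rewrite dotDr (dotC _ r) rv addr0.
Qed.

(** * Solution sets and single steps *)

Lemma halfspace_through n p :
  [set w | dot n (w - p) <= 0] = [set w | dot w n <= dot p n].
Proof.
by apply/seteqP; split=> w /=; rewrite dotDr dotNr !(dotC _ n) subr_le0.
Qed.

(** Monotonicity gives one direction.  Conversely, test the right-hand side at
[p + t (x - p)], divide by [t], and let [t] tend to [0]; continuity of [A] is used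
through its Lipschitz constant, with an explicit [t]. *)
Lemma VI_MintyP (C : set H) (A : H -> H) (L : R) p : convex_set C ->
    monotone_op dot A -> L.-lipschitz A ->
  VI dot C A p <-> C p /\ forall x, C x -> 0 <= dot (A x) (x - p).
Proof.
move=> /convex_setP convC mA lA.
split=> -[Cp hp]; split=> // x Cx.
  by have := hp x Cx; have := mA x p; rewrite !dotE; lra.
rewrite leNgt; apply/negP; set c := dot _ _ => c0.
set N := `|L| * `|x - p| ^+ 2.
have N0 : 0 <= N by rewrite mulr_ge0// sqr_ge0.
pose t := - c / (- c + N).
have cN : 0 < - c + N by lra.
have t0 : 0 < t by rewrite divr_gt0//; lra.
have t1 : t <= 1 by rewrite ler_pdivrMr//; lra.
have t01 : 0 <= t <= 1 by rewrite (ltW t0).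
have := hp _ (convC _ _ _ t01 Cx Cp).
have -> : t *: x + (1 - t) *: p = p + t *: (x - p).
  by rewrite scalerBl scale1r addrCA -scalerBr.
rewrite addrAC subrr add0r dotZr pmulr_rge0// => h.
have lip : `|A (p + t *: (x - p)) - A p| <= `|L| * (t * `|x - p|).
  apply: (le_trans (lA (p + t *: (x - p), p) _)) => //=.
  rewrite addrAC subrr add0r normrZ gtr0_norm//.
  by rewrite ler_wpM2r ?ler_norm// mulr_ge0// ltW.
have := CauchySchwarz_dot (A (p + t *: (x - p)) - A p) (x - p).
rewrite dotDl dotNl -/c => cs.
have := ler_wpM2r (normr_ge0 (x - p)) lip.
have -> : `|L| * (t * `|x - p|) * `|x - p| = t * N by rewrite /N; ring.
move=> /(le_trans cs) {}cs; have {cs} : - c <= t * N by lra.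
rewrite /t mulrAC ler_pdivlMr// => cs.
have : 0 < c * c by rewrite nmulr_rgt0.
by lra.
Qed.

(** Demicontractivity after expanding [T x - z = (x - z) - (x - T x)]; it is linear
in the fixed point [z]. *)
Lemma demicontractive_dotP (lambda : R) (T : H -> H) x z :
  demicontractive lambda T -> Fix T z ->
  (1 - lambda) * `|x - T x| ^+ 2 <= 2 * dot (x - z) (x - T x).
Proof.
move=> dT Tz; have := dT x z Tz.
rewrite (_ : T x - z = (x - z) - (x - T x)) ?normBsqr; first lra.
by rewrite opprB [RHS]addrC subrKA.
Qed.

(** A point in all these half-spaces is fixed, as one sees by taking [x] to be the
point itself. *)
Lemma Fix_halfspaces (lambda : R) (T : H -> H) : lambda < 1 ->
  demicontractive lambda T ->
  Fix T = [set z | forall w c,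
    (exists x, w = x - T x /\
      c = dot x (x - T x) - (1 - lambda) / 2 * `|x - T x| ^+ 2) ->
    dot z w <= c].
Proof.
move=> l1 dT; apply/seteqP; split=> z.
  move=> Tz _ _ [x [-> ->]].
  by have := demicontractive_dotP x dT Tz; rewrite dotDl dotNl; lra.
move=> /(_ (z - T z) _ (ex_intro _ z (conj erefl erefl))) h.
apply/esym/eqP; rewrite -subr_eq0 -normr_eq0 -sqrf_eq0 eq_le sqr_ge0 andbT.
have : 0 < (1 - lambda) / 2 by lra.
by move=> /pmulr_rle0 <-; lra.
Qed.

Lemma VI_halfspaces (C : set H) (A : H -> H) (L : R) : convex_set C ->
    monotone_op dot A -> L.-lipschitz A ->
  VI dot C A = C `&` [set p | forall w c,
    (exists x, [/\ C x, w = A x & c = dot x (A x)]) -> dot p w <= c].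
Proof.
move=> convC mA lA; apply/seteqP; split=> p.
  move=> /(VI_MintyP _ convC mA lA)[Cp hp]; split=> // _ _ [x [Cx -> ->]].
  by have := hp x Cx; rewrite dotDr dotNr !(dotC (A x)); lra.
move=> [Cp hp]; apply/(VI_MintyP _ convC mA lA); split=> // x Cx.
have := hp (A x) _ (ex_intro _ x (And3 Cx erefl erefl)).
by rewrite dotDr dotNr !(dotC (A x)); lra.
Qed.

Lemma convex_setI D D' : convex_set D -> convex_set D' -> convex_set (D `&` D').
Proof.
move=> /convex_setP cD /convex_setP cD'; apply/convex_setP => p q t t01.
by move=> [? ?] [? ?]; split; [exact: cD|exact: cD'].
Qed.

(** Here [f] and [g] stand for the values of the operator at [s] and [y].  The
hypotheses are that [z] lies in the half-space supporting the first projection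
[y], that [z] is the projection of the second half-step, the monotonicity bound
at [p], and the step-size test.  The first three add up to a bound with the
cross term [2 * gamma * dot (f - g) (z - y)], which the test absorbs. *)
Lemma extragradient_step s y z p (f g : H) (gamma kappa : R) :
  0 < gamma -> 0 <= kappa ->
  dot (s - gamma *: f - y) (z - y) <= 0 ->
  dot (s - gamma *: g - z) (p - z) <= 0 ->
  dot g (p - y) <= 0 ->
  gamma * `|f - g| <= kappa * `|s - y| ->
  `|z - p| ^+ 2 <=
    `|s - p| ^+ 2 - (1 - kappa) * (`|s - y| ^+ 2 + `|y - z| ^+ 2).
Proof.
move=> g0 k0 hy hz hg hL.
have cs : gamma * dot (f - g) (z - y) <= kappa * (`|s - y| * `|y - z|).
  rewrite mulrA; apply: le_trans (ler_wpM2r (normr_ge0 _) hL).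
  by rewrite -mulrA ler_pM2l// (distrC y z) CauchySchwarz_dot.
have am : kappa * (2 * (`|s - y| * `|y - z|)) <=
    kappa * (`|s - y| ^+ 2 + `|y - z| ^+ 2).
  by apply: ler_wpM2l => //; have := sqr_ge0 (`|s - y| - `|y - z|); lra.
have {}hg : gamma * dot g (p - y) <= 0 by rewrite pmulr_rle0.
have : `|z - p| ^+ 2 <= `|s - p| ^+ 2 - `|s - y| ^+ 2 - `|y - z| ^+ 2 +
    2 * (gamma * dot (f - g) (z - y)).
  move: hy hz hg; rewrite !norm_dot !dotE.
  rewrite (dotC p s) (dotC y s) (dotC z y) (dotC p z).
  by lra.
by lra.
Qed.

(** Expand the squared norm of a combination of [z - p] and [T z - p] with weights
adding up to [1 - theta]: the cross term becomes a negative multiple of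
[`|z - T z| ^+ 2], part of which pays for the defect of [T]. *)
Lemma demicontractive_step (lambda theta eta : R) (T : H -> H) z p :
    demicontractive lambda T -> Fix T p -> 0 <= eta -> theta <= 1 ->
  `|(1 - theta - eta) *: (z - p) + eta *: (T z - p)| ^+ 2 <=
    (1 - theta) ^+ 2 * `|z - p| ^+ 2 -
    eta * ((1 - lambda) * (1 - theta) - eta) * `|z - T z| ^+ 2.
Proof.
move=> dT Tp e0 t1.
have e1 : 0 <= eta * (1 - theta) by rewrite mulr_ge0//; lra.
have := ler_wpM2l e1 (dT z p Tp).
rewrite (_ : z - T z = (z - p) - (T z - p)); last first.
  by rewrite opprB addrA subrK.
move: (z - p) (T z - p) => d e.
by rewrite !norm_dot !dotE (dotC e d); lra.
Qed.

Lemma weakly_cvg_near (v w : nat -> H) l : weakly_cvg dot v l ->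
  v n - w n @[n --> \oo] --> (0 : H) -> weakly_cvg dot w l.
Proof.
move=> vl vw h.
have d0 : dot (v n - w n) h @[n --> \oo] --> (0 : R).
  apply/cvgn_distP => e e0.
  have d0 : 0 < e / (`|h| + 1) by rewrite divr_gt0// ltr_wpDl.
  have [N hN] := cvgn_distP.1 vw _ d0; exists N => n /hN.
  rewrite !sub0r !normrN ltr_pdivlMr ?ltr_wpDl//; apply: le_lt_trans.
  by apply: (le_trans (norm_dot_le _ _)); rewrite ler_wpM2l// lerDl.
have -> : (fun n => dot (w n) h) = (fun n => dot (v n) h - dot (v n - w n) h).
  by apply/funext => n; rewrite !dotE; ring.
by rewrite -[X in _ --> X]subr0; apply: cvgB => //; exact: vl.
Qed.

End InnerProduct.

(** * The iteration *)

Section ExtragradientIteration.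
Context {R : realType} {H : completeNormedModType R}.
Context (dot : {dot H for @idfun R}).
Context (norm_dot : forall x : H, `|x| ^+ 2 = dot x x).
Context (C : set H) (C_neq0 : C !=set0) (C_closed : closed C).
Context (C_convex : convex_set C).
Context (A T : H -> H) (L : R) (L_gt0 : 0 < L).
Context (A_monotone : monotone_op dot A) (A_lipschitz : L.-lipschitz A).
Context (lambda : R) (lambda_ge0 : 0 <= lambda) (lambda_lt1 : lambda < 1).
Context (T_demicontractive : demicontractive lambda T).
Context (T_demiclosed : demiclosed_at_zero dot T).
Context (theta zeta eta : nat -> R).
Context (theta01 : forall k, (1 <= k)%N -> 0 < theta k < 1).
Context (theta_cvg0 : theta k @[k --> \oo] --> (0 : R)).
Context (theta_sum : (\sum_(1 <= k <oo) (theta k)%:E = +oo)%E).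
Context (zeta_gt0 : forall k, (1 <= k)%N -> 0 < zeta k).
Context (zeta_theta : (zeta k / theta k) @[k --> \oo] --> (0 : R)).
Context (a b : R) (a_gt0 : 0 < a).
Context (eta_ab : forall k, (1 <= k)%N ->
  a < eta k < b /\ b <= (1 - lambda) * (1 - theta k)).
Context (delta : R) (delta_gt0 : 0 < delta).
Context (phi : R) (phi_gt0 : 0 < phi) (phi_lt1 : phi < 1).
Context (x s y z : nat -> H) (delta_ gamma : nat -> R).
Context (gamma1_gt0 : 0 < gamma 1%N).
Context (delta_def : forall k, (1 <= k)%N ->
  delta_ k = if x k != x k.-1
             then Num.min (zeta k / `|x k - x k.-1|) delta else delta).
Context (s_def : forall k, (1 <= k)%N ->
  s k = x k + delta_ k *: (x k - x k.-1)).
Context (y_def : forall k, (1 <= k)%N ->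
  y k = metric_proj C (s k - gamma k *: A (s k))).
Context (z_def : forall k, (1 <= k)%N ->
  z k = metric_proj
          [set w | dot (s k - gamma k *: A (s k) - y k) (w - y k) <= 0]
          (s k - gamma k *: A (y k))).
Context (x_def : forall k, (1 <= k)%N ->
  x k.+1 = (1 - theta k - eta k) *: z k + eta k *: T (z k)).
Context (gamma_def : forall k, (1 <= k)%N ->
  gamma k.+1 = if A (s k) - A (y k) != 0
               then Num.min (phi * `|s k - y k| / `|A (s k) - A (y k)|)
                            (gamma k)
               else gamma k).
Implicit Types (p u w l : H) (e eps M B : R).

Local Notation Omega := (Fix T `&` VI dot C A).

Lemma lipP u w : `|A u - A w| <= L * `|u - w|.
Proof. by apply: (@A_lipschitz (u, w)). Qed.

(** Lower bound of the step sizes: by the Lipschitz condition the first argument of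
the minimum that defines [gamma k.+1] never falls below [phi / L]. *)
Definition gamma_low : R := Num.min (gamma 1%N) (phi / L).

Lemma gamma_low_gt0 : 0 < gamma_low.
Proof. by rewrite lt_min gamma1_gt0 divr_gt0. Qed.

Lemma gamma_ge k : (1 <= k)%N -> gamma_low <= gamma k.
Proof.
case: k => // k _; elim: k => [|k ih]; first by rewrite ge_min lexx.
rewrite gamma_def//; case: ifPn => // nz; rewrite le_min ih andbT.
apply: (@le_trans _ _ (phi / L)); first by rewrite ge_min lexx orbT.
rewrite ler_pdivlMr ?normr_gt0// mulrAC ler_pdivrMr// -mulrA ler_pM2l//.
by rewrite mulrC lipP.
Qed.

Lemma gamma_gt0 k : (1 <= k)%N -> 0 < gamma k.
Proof. by move=> /gamma_ge; apply: lt_le_trans gamma_low_gt0. Qed.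

Lemma gamma_decr k : (1 <= k)%N -> gamma k.+1 <= gamma k.
Proof. by move=> k1; rewrite gamma_def//; case: ifPn => // _; rewrite ge_min lexx orbT. Qed.

Lemma gamma_lip k : (1 <= k)%N ->
  gamma k.+1 * `|A (s k) - A (y k)| <= phi * `|s k - y k|.
Proof.
move=> k1; rewrite gamma_def//; case: ifPn => [nz|].
  by rewrite -ler_pdivlMr ?normr_gt0// ge_min lexx.
by rewrite negbK => /eqP ->; rewrite normr0 mulr0 mulr_ge0// ltW.
Qed.

(** Any number strictly between [phi] and [1] would do. *)
Definition kappa : R := (1 + phi) / 2.

Lemma kappa_lt1 : kappa < 1.
Proof. by move: phi_lt1; rewrite /kappa; lra. Qed.

Lemma kappa_ge0 : 0 <= kappa.
Proof. by move: phi_gt0; rewrite /kappa; lra. Qed.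

Lemma phi_lt_kappa : phi < kappa.
Proof. by move: phi_lt1; rewrite /kappa; lra. Qed.

Lemma lambda_gap : 0 < 1 - lambda.
Proof. by rewrite subr_gt0. Qed.

(** The step sizes decrease and are bounded away from [0], so they converge and
consecutive ones have ratio tending to [1]. *)
Lemma gamma_ratio : exists N, forall k, (N <= k)%N -> (1 <= k)%N ->
  phi * gamma k <= kappa * gamma k.+1.
Proof.
pose g n := gamma n.+1.
have cg : cvgn g.
  apply: nonincreasing_is_cvgn; first by apply/nonincreasing_seqP => n; exact: gamma_decr.
  by exists gamma_low => _ [n _ <-]; exact: gamma_ge.
have e0 : 0 < (kappa - phi) * gamma_low / 2.
  by rewrite divr_gt0// mulr_gt0 ?gamma_low_gt0// subr_gt0 phi_lt_kappa.
have [N hN] := cvgn_distP.1 cg _ e0.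
exists N.+1 => -[//|k] Nk _.
have := hN k Nk; have := hN k.+1 (leq_trans Nk (leqnSn _)).
rewrite !ltr_norml -/(g k) -/(g k.+1) => h1 h2.
have {h1 h2}h : g k - g k.+1 <= (kappa - phi) * gamma_low by lra.
have kp : 0 <= kappa - phi by rewrite subr_ge0 ltW ?phi_lt_kappa.
have := ler_wpM2l kp (gamma_ge (ltn0Sn k.+1)); rewrite -/(g k.+1) => h3.
have := ler_wpM2l (ltW phi_gt0) h.
have : 0 <= (1 - phi) * ((kappa - phi) * gamma_low).
  by rewrite mulr_ge0 ?mulr_ge0 ?(ltW gamma_low_gt0)// subr_ge0 ltW.
by lra.
Qed.

Lemma inertia_le k : (1 <= k)%N -> `|s k - x k| <= zeta k.
Proof.
move=> k1; rewrite s_def// addrAC subrr add0r normrZ delta_def//.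
case: ifPn => [nz|]; last first.
  by rewrite negbK => /eqP ->; rewrite subrr normr0 mulr0 ltW ?zeta_gt0.
have d0 : 0 < `|x k - x k.-1| by rewrite normr_gt0 subr_eq0.
rewrite ger0_norm; last by rewrite le_min !ltW// divr_gt0 ?zeta_gt0.
by rewrite -ler_pdivlMr// ge_min lexx.
Qed.

Lemma y_proj k : (1 <= k)%N -> C (y k) /\ forall q, C q ->
  dot (s k - gamma k *: A (s k) - y k) (q - y k) <= 0.
Proof.
move=> k1; rewrite y_def//.
exact: (metric_projP norm_dot _ C_neq0 (@C_closed) (@C_convex)).
Qed.

Lemma z_proj k : (1 <= k)%N ->
  dot (s k - gamma k *: A (s k) - y k) (z k - y k) <= 0 /\
  forall q, C q -> dot (s k - gamma k *: A (y k) - z k) (q - z k) <= 0.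
Proof.
move=> k1; have [yC hy] := y_proj k1.
have [|||h1 h2] := metric_projP norm_dot (s k - gamma k *: A (y k))
    (D := [set w | dot (s k - gamma k *: A (s k) - y k) (w - y k) <= 0]).
- by exists (y k) => /=; rewrite subrr -(scale0r 0) dotZr mul0r.
- by rewrite halfspace_through; exact: closed_halfspace.
- by rewrite halfspace_through; exact: convex_halfspace.
rewrite -z_def// in h1 h2.
by split=> [//|q Cq]; apply: h2; exact: hy.
Qed.

(** What holds for all large indices; the one-step estimates need only this. *)
Definition regime k : Prop :=
  [/\ (1 <= k)%N, phi * gamma k <= kappa * gamma k.+1, zeta k <= theta k,
      theta k <= 1 / 2 & (1 - lambda) * theta k <= (1 - lambda - b) / 2].

(** The strict gap comes from the first index, where [theta 1 > 0]. *)
Lemma b_lt : b < 1 - lambda.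
Proof.
have [_ h] := eta_ab (leqnn 1).
have /andP[t0 _] := theta01 (leqnn 1).
have l0 := lambda_gap.
by have := mulr_gt0 l0 t0; lra.
Qed.

Lemma regime_eventually : exists N, forall k, (N <= k)%N -> regime k.
Proof.
have [N1 h1] := gamma_ratio.
have [N2 h2] := cvgn_distP.1 zeta_theta _ ltr01.
have half0 : 0 < 1 / 2 :> R by lra.
have [N3 h3] := cvgn_distP.1 theta_cvg0 _ half0.
have l0 := lambda_gap.
have d0 : 0 < (1 - lambda - b) / 2 / (1 - lambda).
  by rewrite !divr_gt0//; have := b_lt; lra.
have [N4 h4] := cvgn_distP.1 theta_cvg0 _ d0.
exists (maxn 1 (maxn N1 (maxn N2 (maxn N3 N4)))) => k.
rewrite !geq_max => /and5P[k1 kN1 kN2 kN3 kN4].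
have /andP[t0 _] := theta01 k1.
split=> //.
- exact: h1.
- have := h2 _ kN2; rewrite sub0r normrN => /ltW/(le_trans (ler_norm _)).
  by rewrite ler_pdivrMr// mul1r.
- by have := h3 _ kN3; rewrite sub0r normrN => /ltW/(le_trans (ler_norm _)).
- have := h4 _ kN4; rewrite sub0r normrN => /ltW/(le_trans (ler_norm _)).
  by rewrite ler_pdivlMr// mulrC.
Qed.

(** * One-step estimates *)

Lemma fejer k p : regime k -> VI dot C A p ->
  `|z k - p| ^+ 2 <= `|s k - p| ^+ 2 -
    (1 - kappa) * (`|s k - y k| ^+ 2 + `|y k - z k| ^+ 2).
Proof.
move=> [k1 hk _ _ _] pV.
have [Cy hy] := y_proj k1; have [hz1 hz2] := z_proj k1.
have [Cp hp] := pV.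
have gk := gamma_gt0 k1.
apply: (extragradient_step norm_dot gk _ hz1 (hz2 _ Cp)).
- exact: kappa_ge0.
- have := A_monotone (y k) p; have := hp _ Cy.
  by rewrite !dotE; lra.
have g1 := gamma_gt0 (ltn0Sn k).
rewrite -(ler_pM2l g1) mulrCA (le_trans (ler_wpM2l (ltW gk) (gamma_lip k1)))//.
rewrite mulrA (mulrC _ phi) (mulrA (gamma k.+1)) (mulrC (gamma k.+1)).
by rewrite ler_wpM2r.
Qed.

Lemma fejer_norm k p : regime k -> VI dot C A p -> `|z k - p| <= `|s k - p|.
Proof.
move=> rk pV; rewrite -(ler_pXn2r (n := 2))// ?nnegrE//.
apply: (le_trans (fejer rk pV)); rewrite gerBl.
apply: mulr_ge0; first by rewrite subr_ge0 (ltW kappa_lt1).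
by apply: addr_ge0; exact: sqr_ge0.
Qed.

Lemma x_split k p : (1 <= k)%N -> x k.+1 - p =
  ((1 - theta k - eta k) *: (z k - p) + eta k *: (T (z k) - p)) - theta k *: p.
Proof.
move=> k1; rewrite x_def// !scalerBr.
have E : p = (1 - theta k - eta k) *: p + eta k *: p + theta k *: p.
  by rewrite -!scalerDl subrK subrK scale1r.
by rewrite [in LHS]E opprD addrA opprD addrACA.
Qed.

Definition residual k : R :=
  `|s k - y k| ^+ 2 + `|y k - z k| ^+ 2 + `|z k - T (z k)| ^+ 2.

Lemma residual_ge0 k : 0 <= residual k.
Proof. by rewrite !addr_ge0// sqr_ge0. Qed.

(** The first argument bounds below the gain of the extragradient step (with
[theta k <= 1 / 2]), the second the gain of the relaxed step. *)
Definition decay : R :=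
  Num.min ((1 - kappa) / 2) (a * ((1 - lambda - b) / 2)).

Lemma decay_gt0 : 0 < decay.
Proof.
rewrite lt_min divr_gt0 ?subr_gt0 ?kappa_lt1//= mulr_gt0// divr_gt0//.
by have := b_lt; lra.
Qed.

Lemma relaxation_step k p : regime k -> Fix T p ->
  `|(1 - theta k - eta k) *: (z k - p) + eta k *: (T (z k) - p)| ^+ 2 <=
    (1 - theta k) ^+ 2 * `|z k - p| ^+ 2 - decay * `|z k - T (z k)| ^+ 2.
Proof.
move=> [k1 _ _ _ hl] Tp.
have /andP[_ /ltW t1] := theta01 k1.
have [/andP[ae eb] hb] := eta_ab k1.
have e0 : 0 <= eta k by apply: ltW; apply: lt_trans ae.
apply: (le_trans (demicontractive_step norm_dot (z k) T_demicontractive Tp e0 t1)).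
rewrite lerD2l lerN2 ler_wpM2r ?sqr_ge0//.
have bl := b_lt.
apply: (@le_trans _ _ (a * ((1 - lambda - b) / 2))); first by rewrite ge_min lexx orbT.
by apply: ler_pM; [exact: ltW|lra|exact: ltW|lra].
Qed.

Lemma x_step_norm k p : regime k -> Omega p ->
  `|x k.+1 - p| <= (1 - theta k) * `|x k - p| + theta k * (1 + `|p|).
Proof.
move=> rk [Tp Vp]; have [k1 _ hz _ _] := rk.
have /andP[/ltW t0 /ltW t1] := theta01 k1.
have t1' : 0 <= 1 - theta k by rewrite subr_ge0.
rewrite x_split//; apply: (le_trans (ler_normB _ _)).
rewrite normrZ (ger0_norm t0) [_ * (1 + _)]mulrDr mulr1 addrA lerD2r.
have := relaxation_step rk Tp; set w := _ + _ => hw.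
have {}hw : `|w| <= (1 - theta k) * `|z k - p|.
  rewrite -(ler_pXn2r (n := 2))// ?nnegrE ?mulr_ge0// exprMn.
  apply: (le_trans hw); rewrite gerBl mulr_ge0 ?sqr_ge0//.
  exact: ltW decay_gt0.
have hs : `|s k - p| <= `|x k - p| + zeta k.
  rewrite -(subrKA (x k)) addrC; apply: (le_trans (ler_normD _ _)).
  by rewrite lerD2l inertia_le.
have := ler_wpM2l t1' (le_trans (fejer_norm rk Vp) hs).
have : theta k * zeta k >= 0 by rewrite mulr_ge0// ltW ?zeta_gt0.
by lra.
Qed.

(** [`|x k.+1 - p|] is at most a convex combination of [`|x k - p|] and [1 + `|p|]. *)
Lemma bounded_iterates p : Omega p ->
  exists N M, 0 <= M /\ forall k, (N <= k)%N -> regime k /\ `|x k - p| <= M.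
Proof.
move=> Op; have [N hN] := regime_eventually.
exists N, (`|x N - p| + (1 + `|p|)); split; first by rewrite !addr_ge0.
move=> k Nk; split; first exact: hN.
move: Nk => /subnK <-; elim: (k - N)%N => [|m ih].
  by rewrite add0n lerDl addr_ge0.
have rk := hN (m + N)%N (leq_addl _ _).
have [k1 _ _ _ _] := rk; have /andP[/ltW t0 /ltW t1] := theta01 k1.
rewrite addSn; apply: (le_trans (x_step_norm rk Op)).
have t1' : 0 <= 1 - theta (m + N)%N by rewrite subr_ge0.
have := ler_wpM2l t1' ih.
have : 0 <= theta (m + N)%N * `|x N - p| by rewrite mulr_ge0.
by lra.
Qed.

(** The extragradient and relaxation estimates are combined through
[`|w - theta k *: p| ^+ 2 <= `|w| ^+ 2 - 2 * theta k * dot p (x k.+1 - p)], where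
[x k.+1 - p = w - theta k *: p]; the inertial step costs
[(2 * M + 1) * zeta k]. *)
Lemma x_step_sqr k p M : regime k -> Omega p -> `|x k - p| <= M ->
  `|x k.+1 - p| ^+ 2 <= (1 - theta k) * `|x k - p| ^+ 2 +
    theta k * (2 * dot p (p - x k.+1) + (2 * M + 1) * (zeta k / theta k)) -
    decay * residual k.
Proof.
move=> rk [Tp Vp] xM; have [k1 _ hz th _] := rk.
have /andP[t0 t1] := theta01 k1.
have z0 := zeta_gt0 k1.
have M0 : 0 <= M by apply: le_trans xM.
have hs : `|s k - p| ^+ 2 <= `|x k - p| ^+ 2 + (2 * M + 1) * zeta k.
  have h : `|s k - p| <= `|x k - p| + zeta k.
    rewrite -(subrKA (x k)) addrC; apply: (le_trans (ler_normD _ _)).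
    by rewrite lerD2l inertia_le.
  have := h; rewrite -(ler_pXn2r (n := 2)) ?nnegrE// ?addr_ge0 ?(ltW z0)//.
  move=> {}h; apply: (le_trans h).
  have := ler_wpM2r (ltW z0) xM.
  have z1 : zeta k <= 1 by lra.
  by have := ler_wpM2l (ltW z0) z1; lra.
have hf := fejer rk Vp.
have := relaxation_step rk Tp.
have := x_split p k1; move: (_ *: (z k - p) + _) => w xw hw.
have {xw} hx : `|x k.+1 - p| ^+ 2 <=
    `|w| ^+ 2 + 2 * (theta k * dot p (p - x k.+1)).
  have -> : p - x k.+1 = - (w - theta k *: p) by rewrite -xw opprB.
  rewrite xw !norm_dot !dotE (dotC dot p w).
  by have := mulr_ge0 (sqr_ge0 (theta k)) (dot_ge0 norm_dot p); lra.
set Z := `|z k - p| ^+ 2 in hf hw.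
have Z0 : 0 <= Z by exact: sqr_ge0.
have t1' : 0 <= 1 - theta k by lra.
have hZ : (1 - theta k) ^+ 2 * Z <= (1 - theta k) * Z.
  have := mulr_ge0 (mulr_ge0 t1' (ltW t0)) Z0; lra.
set sg := `|s k - y k| ^+ 2 + _ in hf.
have sg0 : 0 <= sg by rewrite addr_ge0// sqr_ge0.
have hd : decay * sg <= (1 - theta k) * ((1 - kappa) * sg).
  rewrite mulrA ler_wpM2r//.
  apply: (@le_trans _ _ ((1 - kappa) / 2)); first by rewrite ge_min lexx.
  have k0 : 0 <= 1 - kappa by rewrite subr_ge0 ltW ?kappa_lt1.
  have hh : 0 <= 1 / 2 - theta k by lra.
  by have := mulr_ge0 hh k0; lra.
have := ler_wpM2l t1' (le_trans hf (lerD hs (lexx _))) => hf'.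
have hz' : theta k * ((2 * M + 1) * (zeta k / theta k)) = (2 * M + 1) * zeta k.
  by field; lra.
have := mulr_ge0 (ltW t0) (mulr_ge0 (_ : 0 <= 2 * M + 1) (ltW z0)).
move=> /(_ ltac:(lra)) => hM.
rewrite (mulrDr (theta k)) hz' /residual -/sg mulrDr.
by lra.
Qed.

(** * Weak cluster points and strong convergence *)

(** Demiclosedness gives the fixed point.  For the variational inequality, the
projection defining [y k] bounds [dot (A (s k)) (q - y k)] below by a multiple of
[- `|s k - y k|]; Lipschitz continuity and monotonicity carry this bound over to
[dot (A q) (q - y k)], and the weak limit of the latter is Minty's
inequality. *)
Lemma weak_limit_sol (m : nat -> nat) l B : (forall n, (1 <= m n)%N) ->
    (forall n, `|y (m n)| <= B) ->
    s (m n) - y (m n) @[n --> \oo] --> (0 : H) ->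
    y (m n) - z (m n) @[n --> \oo] --> (0 : H) ->
    z (m n) - T (z (m n)) @[n --> \oo] --> (0 : H) ->
    weakly_cvg dot (fun n => z (m n)) l ->
  Omega l.
Proof.
move=> m1 yB sy yz zT zl; split; first exact: (T_demiclosed zl zT).
have yl : weakly_cvg dot (fun n => y (m n)) l.
  apply: (weakly_cvg_near norm_dot zl); rewrite -oppr0.
  under eq_fun do rewrite -opprB.
  by apply: cvgN.
apply/(VI_MintyP norm_dot _ (@C_convex) A_monotone (@A_lipschitz)); split.
  by apply: (weakly_closed norm_dot (@C_closed) (@C_convex) _ yl) => n; exact: (y_proj (m1 n)).1.
move=> q Cq.
pose c := (gamma_low^-1 + L) * (`|q| + B).
(* monotonicity of [A] between [q] and [y k], then the projection inequality *)
have lower n : - (c * `|s (m n) - y (m n)|) <= dot (A q) (q - y (m n)).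
  set k := m n; have k1 : (1 <= k)%N := m1 n.
  have gl := gamma_low_gt0; have gk := gamma_ge k1.
  have sy0 : 0 <= `|s k - y k| := normr_ge0 _.
  have qyB : `|q - y k| <= `|q| + B.
    by apply: (le_trans (ler_normB _ _)); rewrite lerD2l yB.
  have PB := ler_wpM2l sy0 qyB.
  have := A_monotone q (y k).
  have h1 : - (`|s k - y k| * `|q - y k|) <= gamma k * dot (A (s k)) (q - y k).
    have := (y_proj k1).2 q Cq; rewrite addrAC dotDl dotNl dotZl.
    have := norm_dot_le norm_dot (s k - y k) (q - y k).
    by rewrite ler_norml; lra.
  have h2 : - (L * (`|s k - y k| * `|q - y k|)) <=
            dot (A (y k) - A (s k)) (q - y k).
    have := norm_dot_le norm_dot (A (y k) - A (s k)) (q - y k).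
    have := ler_wpM2r (normr_ge0 (q - y k)) (lipP (y k) (s k)).
    by rewrite (distrC (y k)) ler_norml; lra.
  have P0 : 0 <= `|s k - y k| * `|q - y k| by rewrite mulr_ge0.
  have h3 : - (gamma_low^-1 * (`|s k - y k| * `|q - y k|)) <=
            dot (A (s k)) (q - y k).
    rewrite -mulrN -ler_pdivlMl ?invr_gt0// invrK.
    have [X0|/ltW X0] := lerP 0 (dot (A (s k)) (q - y k)).
      by rewrite (@le_trans _ _ 0) ?oppr_le0// mulr_ge0// ltW.
    exact: (le_trans h1 (ler_wnM2r X0 gk)).
  have := ler_wpM2l (ltW (addr_gt0 (_ : 0 < gamma_low^-1) L_gt0)) PB.
  rewrite invr_gt0 => /(_ gl); rewrite /c.
  move: h2 h3; rewrite !dotDl !dotNl; lra.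
have h1 : - (c * `|s (m n) - y (m n)|) @[n --> \oo] --> (0 : R).
  rewrite -oppr0 -[X in - X](mulr0 c) -[X in c * X](@normr0 _ H).
  by apply: cvgN; apply: cvgM; [exact: cvg_cst|exact: cvg_norm].
have h2 : dot (A q) (q - y (m n)) @[n --> \oo] --> dot (A q) (q - l).
  rewrite dotDr dotNr (dotC dot _ l); under eq_fun do rewrite dotDr dotNr (dotC dot (A q) (y _)).
  by apply: cvgB; [exact: cvg_cst|exact: yl].
by apply: (ler_cvg_to h1 h2); exact: nearW.
Qed.

(** Otherwise there are arbitrarily large [k] with [residual k] arbitrarily small
and [dot u (u - x k.+1) > eps]; a weak limit [l] of the corresponding [z k] is a
solution and also the weak limit of the [x k.+1], so
[dot u (u - l) >= eps > 0], against the hypothesis on [u]. *)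
Lemma residual_small u eps : Omega u ->
    (forall p, Omega p -> 0 <= dot u (p - u)) -> 0 < eps ->
  exists e N, 0 < e /\ forall k, (N <= k)%N -> residual k <= e ->
    dot u (u - x k.+1) <= eps.
Proof.
move=> Ou umin eps0; apply: contrapT => no.
have [N [M [M0 hN]]] := bounded_iterates Ou.
have /choice[mm hmm] n : exists k, [/\ (n <= k)%N, (N <= k)%N,
    residual k <= harmonic n & eps < dot u (u - x k.+1)].
  apply: contrapT => nok; apply: no.
  exists (harmonic n), (maxn n N); split; first exact: harmonic_gt0.
  move=> k; rewrite geq_max => /andP[nk Nk] rk.
  by rewrite leNgt; apply/negP => ek; apply: nok; exists k.
pose B := `|u| + (M + 1).
have zB k : (N <= k)%N -> `|z k| <= B.
  move=> /hN[rk xM]; have [k1 _ hz _ _] := rk.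
  have /andP[_ t1] := theta01 k1.
  rewrite -(subrK u (z k)) addrC; apply: (le_trans (ler_normD _ _)).
  rewrite lerD2l; apply: (le_trans (fejer_norm rk Ou.2)).
  rewrite -(subrKA (x k)) addrC; apply: (le_trans (ler_normD _ _)).
  by have := inertia_le k1; lra.
have [f [l [fn zl]]] : exists (f : nat -> nat) l, (forall n, (n <= f n)%N) /\
    weakly_cvg dot (fun n => z (mm (f n))) l.
  apply: (weak_subsequence norm_dot (v := fun n => z (mm n)) (M := B)) => n.
  by have [_ Nk _ _] := hmm n; exact: zB.
pose m n := mm (f n).
have Nm n : (N <= m n)%N by have [] := hmm (f n).
have nm n : (n <= m n)%N by have [+ _ _ _] := hmm (f n); apply: leq_trans.
have m1 n : (1 <= m n)%N by have [[]] := hN _ (Nm n).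
have rm n : residual (m n) <= harmonic n.
  have [_ _ + _] := hmm (f n) => /le_trans; apply.
  by rewrite /harmonic /= lef_pV2 ?posrE// ler_nat ltnS.
have sqr0 := sqr_ge0.
have zT : z (m n) - T (z (m n)) @[n --> \oo] --> (0 : H).
  apply: cvg0_harmonic_sqr => n; apply: le_trans (rm n).
  by rewrite /residual lerDr addr_ge0.
have yz2 n : `|y (m n) - z (m n)| ^+ 2 <= harmonic n.
  apply: le_trans (rm n).
  by rewrite /residual addrAC lerDr addr_ge0.
have sy : s (m n) - y (m n) @[n --> \oo] --> (0 : H).
  apply: cvg0_harmonic_sqr => n; apply: le_trans (rm n).
  by rewrite /residual -addrA lerDl addr_ge0.
have yB n : `|y (m n)| <= B + 1.
  rewrite -(subrK (z (m n)) (y _)) addrC; apply: (le_trans (ler_normD _ _)).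
  rewrite lerD ?zB// -(ler_pXn2r (n := 2)) ?nnegrE// expr1n.
  by apply: (le_trans (yz2 n)); rewrite /harmonic /= invf_le1 ?ler1n.
have Ol := weak_limit_sol m1 yB sy (cvg0_harmonic_sqr yz2) zT zl.
have xl : weakly_cvg dot (fun n => x (m n).+1) l.
  apply: (weakly_cvg_near norm_dot zl); apply/cvgn_distP => e e0.
  have B0 : 0 < B + 1 by rewrite /B; have := normr_ge0 u; lra.
  have [N1 hN1] := cvgn_distP.1 theta_cvg0 _ (divr_gt0 (divr_gt0 e0 (ltr0Sn R 1)) B0).
  have [N2 hN2] := cvgn_distP.1 zT _ (divr_gt0 e0 (ltr0Sn R 1)).
  exists (maxn N1 N2) => n; rewrite geq_max => /andP[n1 n2].
  have := hN1 _ (leq_trans n1 (nm n)); rewrite sub0r normrN ltr_pdivlMr// => h1.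
  have := hN2 _ n2; rewrite !sub0r !normrN => h2.
  have /andP[/ltW t0 _] := theta01 (m1 n).
  have [/andP[ae eb] _] := eta_ab (m1 n).
  have -> : z (m n) - x (m n).+1 =
      theta (m n) *: z (m n) + eta (m n) *: (z (m n) - T (z (m n))).
    rewrite x_def// scalerBr addrA -scalerDl opprD addrA.
    rewrite -{1}[z (m n)]scale1r -scalerBl; congr (_ *: _ - _); ring.
  apply: (le_lt_trans (ler_normD _ _)); rewrite !normrZ.
  have e1 : `|eta (m n)| <= 1.
    rewrite ger0_norm; last by apply: ltW; apply: lt_trans ae.
    by have := b_lt; move: lambda_ge0; lra.
  have := ler_wpM2r (normr_ge0 (z (m n) - T (z (m n)))) e1.
  have := ler_wpM2l (normr_ge0 (theta (m n))) (zB _ (Nm n)).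
  by have := normr_ge0 (theta (m n)); lra.
have h : dot u (u - x (m n).+1) @[n --> \oo] --> dot u (u - l).
  rewrite dotDr dotNr (dotC dot _ l).
  under eq_fun do rewrite dotDr dotNr (dotC dot u (x _)).
  by apply: cvgB; [exact: cvg_cst|exact: xl].
have : eps <= dot u (u - l).
  apply: (closed_cvg _ (@closed_ge _ eps) _ _ h); apply: nearW => n /=.
  by have [_ _ _ /ltW] := hmm (f n).
by have := umin l Ol; rewrite !dotDr !dotNr; lra.
Qed.

(** For each tolerance, the recursion of eventually_small holds on both sides of
the alternative on the size of [residual k]. *)
Lemma iterates_cvg_min_norm : Omega !=set0 -> exists u, [/\ Omega u,
  forall p, Omega p -> `|u| <= `|p| & x k @[k --> \oo] --> u].
Proof.
move=> O0.
have [cO vO] : closed Omega /\ convex_set (Omega : set H).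
  rewrite (Fix_halfspaces norm_dot lambda_lt1 T_demicontractive).
  rewrite (VI_halfspaces norm_dot (@C_convex) A_monotone (@A_lipschitz)).
  split.
    by apply: closedI; [exact: closed_halfspaces|apply: closedI => //; exact: closed_halfspaces].
  by apply: convex_setI; [exact: convex_halfspaces|apply: convex_setI => //; exact: convex_halfspaces].
have [Ou hu] := metric_projP norm_dot 0 O0 cO vO.
set u := metric_proj Omega 0 in Ou hu.
have umin p : Omega p -> 0 <= dot u (p - u).
  by move=> /hu; rewrite sub0r dotNl oppr_le0.
exists u; split=> // [p Op|].
  rewrite -(ler_pXn2r (n := 2))// ?nnegrE//.
  rewrite -[in leRHS](subrK u p) (normDsqr norm_dot) (dotC dot _ u).
  by have := umin p Op; have := sqr_ge0 `|p - u|; lra.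
have [N [M [M0 hN]]] := bounded_iterates Ou.
have tsum : forall B : R, exists n, B < \sum_(1 <= k < n) theta k.
  by apply: divergent_partial_sums => // k /theta01/andP[/ltW].
apply/cvgn_distP => d d0.
pose eps := d ^+ 2 / 4.
have eps0 : 0 < eps by rewrite divr_gt0 ?exprn_gt0.
have eps40 : 0 < eps / 4 by rewrite divr_gt0.
have [e [N1 [e0 hN1]]] := residual_small Ou umin eps40.
have M1 : 0 < 2 * M + 1 by lra.
have [N2 hN2] := cvgn_distP.1 zeta_theta _ (divr_gt0 (divr_gt0 eps0 (ltr0Sn R 1)) M1).
pose Bc := 2 * (`|u| * M) + (2 * M + 1).
have Bc0 : 0 < Bc by rewrite /Bc ltr_wpDl// !mulr_ge0.
have [N3 hN3] := cvgn_distP.1 theta_cvg0 _ (divr_gt0 (mulr_gt0 decay_gt0 e0) Bc0).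
pose K := maxn (maxn 1 N) (maxn N1 (maxn N2 N3)).
have [N' hN'] : exists N', forall n, (N' <= n)%N -> `|x n - u| ^+ 2 <= 2 * eps.
  apply: (@eventually_small _ _ theta _ K) => // [|k].
    by rewrite !leq_max leqnn.
  rewrite !geq_max => /andP[/andP[k1 Nk] /and3P[k_1 k2 k3]].
  have [rk xM] := hN _ Nk; have [_ _ hz _ _] := rk.
  have [_ xM'] := hN _ (leq_trans Nk (leqnSn k)).
  have /andP[t0 t1] := theta01 k1.
  apply: (le_trans (x_step_sqr rk Ou xM)).
  have [re|re] := lerP (residual k) e.
    (* small residual: [residual_small] bounds the coefficient of [theta k] *)
    have h1 := hN1 _ k_1 re.
    have h2 : (2 * M + 1) * (zeta k / theta k) <= eps / 2.
      have := hN2 _ k2; rewrite sub0r normrN ltr_pdivlMr// => /ltW.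
      by apply: le_trans; rewrite mulrC ler_wpM2r ?(ltW M1)// ler_norm.
    have h3 : 2 * dot u (u - x k.+1) + (2 * M + 1) * (zeta k / theta k) <= eps by lra.
    have := ler_wpM2l (ltW t0) h3.
    by have := mulr_ge0 (ltW decay_gt0) (residual_ge0 k); lra.
  (* large residual: by the choice of [N3], [theta k * Bc < decay * e] *)
  have h1 : dot u (u - x k.+1) <= `|u| * M.
    apply: (le_trans (CauchySchwarz_dot norm_dot _ _)).
    by rewrite ler_wpM2l// distrC.
  have h2 : (2 * M + 1) * (zeta k / theta k) <= 2 * M + 1.
    by rewrite ler_piMr ?(ltW M1)// ler_pdivrMr// mul1r.
  have h3 : 2 * dot u (u - x k.+1) + (2 * M + 1) * (zeta k / theta k) <= Bc.
    by rewrite /Bc; lra.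
  have := ler_wpM2l (ltW t0) h3.
  have := hN3 _ k3; rewrite sub0r normrN ger0_norm ?(ltW t0)// ltr_pdivlMr//.
  have := ler_wpM2l (ltW decay_gt0) (ltW re).
  by have := mulr_gt0 t0 eps0; lra.
exists N' => n /hN' h; rewrite distrC -(ltr_pXn2r (n := 2))// ?nnegrE ?(ltW d0)//.
by apply: (le_lt_trans h); rewrite /eps; have := exprn_gt0 2 d0; lra.
Qed.

End ExtragradientIteration.

Theorem theorem1 (R : realType) (H : completeNormedModType R)
  (dot : {dot H for @idfun R})
  (norm_dot : forall x : H, `|x| ^+ 2 = dot x x)
  (C : set H) (C_neq0 : C !=set0) (C_closed : closed C)
  (C_convex : convex_set C)
  (A T : H -> H)
  (L : R) (L_gt0 : 0 < L)
  (A_monotone : monotone_op dot A) (A_lipschitz : L.-lipschitz A)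
  (lambda : R) (lambda_ge0 : 0 <= lambda) (lambda_lt1 : lambda < 1)
  (T_demicontractive : demicontractive lambda T)
  (T_demiclosed : demiclosed_at_zero dot T)
  (sol_neq0 : Fix T `&` VI dot C A !=set0)
  (theta zeta eta : nat -> R)
  (theta01 : forall k, (1 <= k)%N -> 0 < theta k < 1)
  (theta_cvg0 : theta k @[k --> \oo] --> (0 : R))
  (theta_sum : (\sum_(1 <= k <oo) (theta k)%:E = +oo)%E)
  (zeta_gt0 : forall k, (1 <= k)%N -> 0 < zeta k)
  (zeta_theta : (zeta k / theta k) @[k --> \oo] --> (0 : R))
  (eta_gt0 : forall k, (1 <= k)%N -> 0 < eta k)
  (a b : R) (a_gt0 : 0 < a) (b_gt0 : 0 < b)
  (eta_ab : forall k, (1 <= k)%N ->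
     (a < eta k < b) /\
     [set` `]a, b[] `<=` [set` `]0, ((1 - lambda) * (1 - theta k))[])
  (delta : R) (delta_gt0 : 0 < delta)
  (phi : R) (phi_gt0 : 0 < phi) (phi_lt1 : phi < 1)
  (x s y z : nat -> H) (delta_ gamma : nat -> R)
  (gamma1_gt0 : 0 < gamma 1%N)
  (delta_def : forall k, (1 <= k)%N ->
     delta_ k = if x k != x k.-1
                then Num.min (zeta k / `|x k - x k.-1|) delta else delta)
  (s_def : forall k, (1 <= k)%N ->
     s k = x k + delta_ k *: (x k - x k.-1))
  (y_def : forall k, (1 <= k)%N ->
     y k = metric_proj C (s k - gamma k *: A (s k)))
  (z_def : forall k, (1 <= k)%N ->
     z k = metric_proj
             [set w | dot (s k - gamma k *: A (s k) - y k) (w - y k) <= 0]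
             (s k - gamma k *: A (y k)))
  (x_def : forall k, (1 <= k)%N ->
     x k.+1 = (1 - theta k - eta k) *: z k + eta k *: T (z k))
  (gamma_def : forall k, (1 <= k)%N ->
     gamma k.+1 = if A (s k) - A (y k) != 0
                  then Num.min (phi * `|s k - y k| / `|A (s k) - A (y k)|)
                               (gamma k)
                  else gamma k) :
  exists u : H,
    [/\ (Fix T `&` VI dot C A) u,
        forall p : H, (Fix T `&` VI dot C A) p -> `|u| <= `|p|
      & x k @[k --> \oo] --> u].
Proof.
apply: (iterates_cvg_min_norm (b := b) norm_dot C_neq0 C_closed C_convex L_gt0
  A_monotone A_lipschitz lambda_ge0 lambda_lt1 T_demicontractive T_demiclosed
  theta01 theta_cvg0 theta_sum zeta_gt0 zeta_theta a_gt0 _ delta_gt0 phi_gt0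
  phi_lt1 gamma1_gt0 delta_def s_def y_def z_def x_def gamma_def sol_neq0).
move=> k k1; have [ab sub] := eta_ab k k1; split=> //.
have a_lt_b : a < b by case/andP: ab; exact: lt_trans.
exact: (itv_sub_le a_lt_b sub).
Qed.
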